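(* Let the source data $(X_S,Y_S)$, kernel $k(x,x')=\langle\Phi(x),\Phi(x')\rangle$, kernel matrix $K_S=k(X_S,X_S)$, $\sigma_S>0$, source model $f_S(\cdot)^T=k(\cdot,X_S)[K_S+\sigma_S I]^{-1}Y_S$, input transformation $a$ with parameters $\theta_A$, linear output mapping $b\in\mathbb{R}^{c_T\times c_S}$, target model $f_T=b\circ f_S\circ a$, and target dataset $D_T$ with feature matrix $X_T$ be as in the context. Define $\hat\Theta_T^A(x,x')=\nabla_{\theta_A}f_T(x)[\nabla_{\theta_A}f_T(x')]^T$, $\hat\Theta_A(x,x')=\nabla_{\theta_A}a(x)[\nabla_{\theta_A}a(x')]^T$ and $\hat\Theta_S^A(x,x')=\nabla_a\Phi(a(x))[\nabla_a\Phi(a(x'))]^T$. Suppose that $c_A>0$ is such that $$\lambda_{\min}[\hat\Theta_S^A(x_t,x_t)]\ge c_A\,(\lambda_{\max}[K_S]+\sigma_S)\qquad\text{for all }(x_t,y_t)\in D_T .$$ Then for every $i\in\{1,\dots,N_Tc_T\}$, $$\lambda_i\big(\hat\Theta_T^A(X_T,X_T)\big)\ge\lambda_{\min}(b\,Y_S^TY_S\,b^T)\cdot\left[\frac{c_A\,\lambda_{\min}[K_S]}{\lambda_{\min}[K_S]+\sigma_S}\right]\cdot\lambda_{\min}[\hat\Theta_A(X_T,X_T)].$$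
   Context: Source data: $X_S=[x_s^1,\dots,x_s^{N_S}]^T\in\mathbb{R}^{N_S\times d_S}$, $Y_S=[y_s^1,\dots,y_s^{N_S}]^T\in\mathbb{R}^{N_S\times c_S}$. Target data: $D_T=\{(x_i,y_i)\}_{i=1}^{N_T}$, $x_i\in\mathbb{R}^{d_T}$, $y_i\in\mathbb{R}^{c_T}$, with feature matrix $X_T\in\mathbb{R}^{N_T\times d_T}$. The kernel $k:\mathbb{R}^{d_S}\times\mathbb{R}^{d_S}\to\mathbb{R}$ (symmetric, positive semi-definite; induced by the neural tangent kernel of the source network) is given by a differentiable feature map $\Phi:\mathbb{R}^{d_S}\to\mathbb{R}^m$ as $k(x,x')=\langle\Phi(x),\Phi(x')\rangle$. $\Phi(X_S)$ is the $m\times N_S$ matrix with columns $\Phi(x_s^j)$, so $K_S=k(X_S,X_S)=\Phi(X_S)^T\Phi(X_S)$, and $k(x,X_S)=\Phi(x)^T\Phi(X_S)$ is a $1\times N_S$ row. The source model $f_S:\mathbb{R}^{d_S}\to\mathbb{R}^{c_S}$ is the fixed kernel model $f_S(x)^T=k(x,X_S)[K_S+\sigma_S I]^{-1}Y_S$ with $\sigma_S>0$. The input transformation $a=a_{\theta_A}:\mathbb{R}^{d_T}\to\mathbb{R}^{d_S}$ is differentiable in its parameter vector $\theta_A\in\mathbb{R}^{p_A}$. The output mapping $b$ is a linear map given by a $c_T\times c_S$ matrix. The target model is $f_T(x)=b\,f_S(a(x))$. All quantities are evaluated at fixed $\theta_A$ and $b$. $\nabla_{\theta_A}f_T(x)\in\mathbb{R}^{c_T\times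 p_A}$ and $\nabla_{\theta_A}a(x)\in\mathbb{R}^{d_S\times p_A}$ are Jacobians with respect to $\theta_A$; $\nabla_a\Phi(a(x))\in\mathbb{R}^{m\times d_S}$ is the Jacobian of $\Phi$ evaluated at $a(x)$. For a matrix-valued function $M(x,x')\in\mathbb{R}^{r\times r}$, $M(X_T,X_T)$ is the $N_Tr\times N_Tr$ block matrix whose $(i,j)$ block is $M(x_i,x_j)$. For a symmetric matrix, $\lambda_i$ is the $i$-th largest eigenvalue, and $\lambda_{\max},\lambda_{\min}$ are the largest and smallest eigenvalues. *)

(* Defs.v *)
(* MathComp / MathComp-Analysis, over an arbitrary R : realType.
   Vectors of R^n are row vectors 'rV[R]_n; a data matrix stacks samples as
   rows. *)
From mathcomp Require Import all_boot all_order all_algebra.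
From mathcomp Require Import all_classical all_reals all_analysis.
From mathcomp Require Import polyrcf.
Import Order.TTheory GRing.Theory Num.Theory.
Import numFieldNormedType.Exports.

Set Implicit Arguments.
Unset Strict Implicit.
Unset Printing Implicit Defensive.

Local Open Scope ring_scope.

(* The real eigenvalues of A, in decreasing order, each repeated according to
   its multiplicity as a root of the characteristic polynomial. For a
   symmetric n x n matrix this list has length n. *)
Definition eigvals (R : rcfType) n (A : 'M[R]_n) : seq R :=
  flatten [seq nseq (mup x (char_poly A)) x | x <- rev (rootsR (char_poly A))].

(* i-th largest eigenvalue, counted from i = 1. *)
Definition lambda (R : rcfType) n (i : nat) (A : 'M[R]_n) : R :=
  nth 0 (eigvals A) i.-1.

Definition lambda_max (R : rcfType) n (A : 'M[R]_n) : R := head 0 (eigvals A).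

Definition lambda_min (R : rcfType) n (A : 'M[R]_n) : R := last 0 (eigvals A).

(* The library's 'J f x acts on row vectors on the right (it is n x m); the
   transpose is the usual m x n Jacobian (d f_i / d x_j)_(i, j). *)
Definition grad (R : realType) n m (f : 'rV[R]_n -> 'rV[R]_m) (x : 'rV[R]_n) :
  'M[R]_(m, n) := (jacobian f x)^T.

(* M(X, X): the (i, j) block is M(x_i, x_j), with x_i the i-th row of X. *)
Definition block_gram (R : realType) N d r
    (M : 'rV[R]_d -> 'rV[R]_d -> 'M[R]_r) (X : 'M[R]_(N, d)) :
    'M[R]_(\sum_(i < N) r) :=
  \mxblock_(i < N, j < N) M (row i X) (row j X).

Section Model.
Variables (R : realType) (dS cS dT cT NS m pA : nat).
Variables (Phi : 'rV[R]_dS -> 'rV[R]_m).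
Variables (XS : 'M[R]_(NS, dS)) (YS : 'M[R]_(NS, cS)) (sigmaS : R).
Variables (a : 'rV[R]_pA -> 'rV[R]_dT -> 'rV[R]_dS) (b : 'M[R]_(cT, cS)).

Definition kernel (x x' : 'rV[R]_dS) : R := \sum_(l < m) Phi x 0 l * Phi x' 0 l.

Definition kernel_mx p q (X : 'M[R]_(p, dS)) (X' : 'M[R]_(q, dS)) :
  'M[R]_(p, q) := \matrix_(i, j) kernel (row i X) (row j X').

Definition K_S : 'M[R]_NS := kernel_mx XS XS.

(* As values are row vectors, this is the row f_S(x)^T. *)
Definition f_S (x : 'rV[R]_dS) : 'rV[R]_cS :=
  kernel_mx x XS *m invmx (K_S + sigmaS%:M) *m YS.

(* The column identity f_T(x) = b f_S(a(x)), transposed. *)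
Definition f_T (theta : 'rV[R]_pA) (x : 'rV[R]_dT) : 'rV[R]_cT :=
  f_S (a theta x) *m b^T.

Variable theta : 'rV[R]_pA.

Definition Theta_TA (x x' : 'rV[R]_dT) : 'M[R]_cT :=
  grad (fun t => f_T t x) theta *m (grad (fun t => f_T t x') theta)^T.

Definition Theta_A (x x' : 'rV[R]_dT) : 'M[R]_dS :=
  grad (fun t => a t x) theta *m (grad (fun t => a t x') theta)^T.

Definition Theta_SA (x x' : 'rV[R]_dT) : 'M[R]_m :=
  grad Phi (a theta x) *m (grad Phi (a theta x'))^T.

End Model.

Definition features (R : realType) N d c (D : N.-tuple ('rV[R]_d * 'rV[R]_c)) :
  'M[R]_(N, d) := \matrix_(i < N) (tnth D i).1.

(* Main.v *)
(** Write P = b Y_S^T (K_S + sigma_S I)^-1 Phi(X_S)^T. By the chain rule the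
    Jacobian of f_T at x is P (grad Phi) (grad a), so the target Gram matrix is
    D Theta_A D^T with D block diagonal of blocks P (grad Phi)(a x_i), and its
    Rayleigh quotients are at least lambda_min(Theta_A) times the smallest
    squared singular value of the blocks. With u = v b Y_S^T (K_S + sigma_S I)^-1
    one has |v P|^2 = u K_S u^T; since t / (t + sigma) is increasing and
    t + sigma <= lambda_max + sigma on the spectrum of K_S,
      (lambda_max + sigma) t >= lambda_min / (lambda_min + sigma) (t + sigma)^2,
    which the hypothesis on Theta_SA turns into the bound. *)
Require Import Defs.
From mathcomp Require Import all_boot all_order all_algebra.
From mathcomp Require Import all_classical all_reals all_analysis.
From mathcomp Require Import complex polyrcf spectral ring lra.
Import Order.TTheory GRing.Theory Num.Theory.
Import numFieldNormedType.Exports.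
Local Open Scope ring_scope.

Set Implicit Arguments.
Unset Strict Implicit.
Unset Printing Implicit Defensive.

(** * Spectral theorem for real symmetric matrices and the list [eigvals] *)

Lemma char_poly_conj (F : fieldType) n (P B : 'M[F]_n) : P \in unitmx ->
  char_poly (invmx P *m B *m P) = char_poly B.
Proof.
move=> Pu; rewrite /char_poly.
have -> : char_poly_mx (invmx P *m B *m P) =
    map_mx polyC (invmx P) *m char_poly_mx B *m map_mx polyC P.
  rewrite /char_poly_mx mulmxBr mulmxBl !map_mxM; congr (_ - _).
  by rewrite mul_mx_scalar -scalemxAl -map_mxM mulVmx // map_mx1 scalemx1.
by rewrite !det_mulmx mulrAC -det_mulmx -map_mxM mulVmx // map_mx1 det1 mul1r.
Qed.

(* w i is the squared modulus of the i-th coordinate of v in a unitary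
   eigenbasis of A over R[i]. *)
Lemma symmetric_spectral (R : rcfType) n (A : 'M[R]_n) : A^T = A ->
  exists d : 'I_n -> R,
    char_poly A = \prod_(i < n) ('X - (d i)%:P) /\
    forall v : 'rV[R]_n, exists w : 'I_n -> R,
      [/\ forall i, 0 <= w i,
          (v *m v^T) 0 0 = \sum_i w i,
          (v *m A *m v^T) 0 0 = \sum_i d i * w i &
          (v *m A *m A *m v^T) 0 0 = \sum_i d i ^+ 2 * w i].
Proof.
move=> Asym; pose f := real_complex R; pose Ac := map_mx f A.
have realf p q (B : 'M[R]_(p, q)) : map_mx Num.conj (map_mx f B) = map_mx f B.
  by apply/matrixP => i j; rewrite !mxE; apply/CrealP/complex_realP; exists (B i j).
(* A real symmetric matrix is Hermitian over [R[i]], hence unitarily diagonalisable with real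
   spectrum; [d] is that spectrum read back in [R]. *)
have Aherm : Ac \is hermsymmx.
  apply/is_hermitianmxP; by rewrite expr0 scale1r /Ac map_trmx Asym realf.
have /mxOverP dreal := hermitian_spectral_diag_real Aherm.
have /hermitian_normalmx/orthomx_spectralP := Aherm.
have := spectral_unitarymx Ac.
set P := spectralmx Ac; set dc := spectral_diag Ac => Pu AE.
pose d i := complex.Re (dc 0 i).
have dE i : dc 0 i = f (d i) by rewrite /f RRe_real.
exists d; split.
  apply: (map_poly_inj f).
  rewrite map_char_poly -/Ac AE char_poly_conj ?unitarymx_unit //.
  rewrite char_poly_trig ?diag_mx_is_trig // rmorph_prod.
  by apply: eq_bigr => i _; rewrite rmorphB /= map_polyX map_polyC mxE eqxx /= dE.
move=> v; pose vc := map_mx f v; pose u := vc *m invmx P.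
(* As [P] is unitary, its inverse is its conjugate transpose, and [vc] is real. Each quadratic form
   below thus becomes a sum of multiples of [|u_i|^2]. *)
have uT : P *m vc^T = map_mx Num.conj u^T.
  rewrite /u invmx_unitary // trmx_mul map_mxM /=.
  by rewrite trmxCK /vc [in RHS]map_trmx realf map_trmx.
have uu i : u 0 i * (u 0 i)^* = f (complex.Re (`|u 0 i| ^+ 2)).
  by rewrite -normCK /f RRe_real // rpredX // normr_real.
have uTE i : (map_mx Num.conj u^T) i 0 = (u 0 i)^* by rewrite !mxE.
have Punit := unitarymx_unit Pu.
exists (fun i => complex.Re (`|u 0 i| ^+ 2)); split.
- move=> i; have : 0 <= f (complex.Re (`|u 0 i| ^+ 2)).
    by rewrite -uu -normCK exprn_ge0.
  by rewrite ler0c.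
- apply: (fmorph_inj f); rewrite rmorph_sum.
  transitivity ((vc *m vc^T) 0 0).
    by rewrite /vc map_trmx -map_mxM [RHS]mxE.
  rewrite -[X in X *m _](mulmxKV Punit) -/u -mulmxA uT mxE.
  by apply: eq_bigr => i _; rewrite uTE uu.
- apply: (fmorph_inj f); rewrite rmorph_sum.
  transitivity ((vc *m Ac *m vc^T) 0 0).
    by rewrite /vc map_trmx -!map_mxM [RHS]mxE.
  rewrite AE !mulmxA -/u -mulmxA uT mxE.
  apply: eq_bigr => i _; rewrite mul_mx_diag uTE.
  by rewrite [(\matrix_(_, _) _) _ _]mxE mulrAC uu dE -rmorphM mulrC.
- apply: (fmorph_inj f); rewrite rmorph_sum.
  transitivity ((vc *m Ac *m Ac *m vc^T) 0 0).
    by rewrite /vc map_trmx -!map_mxM [RHS]mxE.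
  (* The inner [P *m invmx P] cancels between the two copies of the decomposition, leaving the
     square of the diagonal. *)
  rewrite AE !mulmxA mulmxK // -/u -mulmxA uT mxE.
  apply: eq_bigr => i _; rewrite !mul_mx_diag uTE 2![(\matrix_(_, _) _) _ _]mxE.
  by rewrite 2!(mulrAC _ _ (u 0 i)^* ) uu dE -!rmorphM expr2 -mulrA mulrC.
Qed.

(** Both lists contain each [x] as often as its multiplicity in the characteristic polynomial:
    [eigvals] because its blocks belong to distinct roots, [codom d] by the factorisation. *)
Lemma eigvals_perm (R : rcfType) n (A : 'M[R]_n) (d : 'I_n -> R) :
  char_poly A = \prod_(i < n) ('X - (d i)%:P) ->
  perm_eq (eigvals A) (codom d).
Proof.
move=> pE.
have p0 : char_poly A != 0 by rewrite monic_neq0 // char_poly_monic.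
have mE x : mup x (char_poly A) = count_mem x (codom d).
  by rewrite pE -mu_prod_XsubC big_map big_enum.
have count_flatten (m : R -> nat) x r : uniq r ->
    count_mem x (flatten [seq nseq (m y) y | y <- r]) = ((x \in r) * m x)%N.
  elim: r => [|y r IH] //= /andP[yr ur].
  rewrite count_cat count_nseq IH // in_cons /= eq_sym.
  case: eqVneq => [->|_] /=; last by rewrite mul0n.
  by rewrite (negPf yr) mul0n addn0.
apply/allP => x _ /=; rewrite count_flatten; last first.
  by rewrite rev_uniq (sorted_uniq lt_trans ltxx) // sorted_roots.
rewrite mem_rev -(roots_on_rootsR p0) in_itv andTb -mE.
(* Outside the roots the multiplicity is 0, so the membership factor makes no difference. *)
have [_|/mupNroot->] := boolP (root _ _); first by rewrite mul1n.
by rewrite muln0.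
Qed.

Lemma eigvals_sorted (R : rcfType) n (A : 'M[R]_n) : pairwise >=%O (eigvals A).
Proof.
rewrite /eigvals; have : pairwise >%O (rev (rootsR (char_poly A))).
  rewrite -sorted_pairwise; first by rewrite rev_sorted sorted_roots.
  by move=> x y z xy yz; exact: lt_trans xy.
elim: rev => [//|y r IH] /= /andP[yr /IH pr].
rewrite pairwise_cat pr andbT; apply/andP; split.
  apply/allrelP => a c /nseqP[-> _] /flatten_mapP[z zr /nseqP[-> _]].
  exact/ltW/(allP yr).
elim: (mup _ _) => //= k ->; rewrite andbT.
by apply/allP => z /nseqP[-> _] /=.
Qed.

Lemma last_pairwise_ge (R : porderType ring_display) (x0 x : R) (s : seq R) :
  pairwise >=%O s -> x \in s -> last x0 s <= x.
Proof.
case/lastP: s => // s y; rewrite pairwise_rcons last_rcons mem_rcons in_cons.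
by case/andP => /allP h _ /orP[/eqP-> //|/h].
Qed.

Lemma head_pairwise_ge (R : porderType ring_display) (x0 x : R) (s : seq R) :
  pairwise >=%O s -> x \in s -> x <= head x0 s.
Proof.
case: s => // y s /= /andP[/allP h _]; rewrite in_cons.
by case/orP => [/eqP-> //|/h].
Qed.

(** Reduces inequalities between quadratic forms in [A] and its square to scalar inequalities on the
    interval from [lambda_min A] to [lambda_max A]. *)
Lemma quad_eigvals (R : rcfType) n (A : 'M[R]_n) : A^T = A ->
  exists d : 'I_n -> R,
    (forall i, lambda_min A <= d i <= lambda_max A) /\
    forall v : 'rV[R]_n, exists w : 'I_n -> R,
      [/\ forall i, 0 <= w i,
          (v *m v^T) 0 0 = \sum_i w i,
          (v *m A *m v^T) 0 0 = \sum_i d i * w i &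
          (v *m A *m A *m v^T) 0 0 = \sum_i d i ^+ 2 * w i].
Proof.
move=> /symmetric_spectral[d [/eigvals_perm/perm_mem dE dv]]; exists d; split=> // i.
have di : d i \in eigvals A by rewrite dE codom_f.
have As := eigvals_sorted A.
by rewrite last_pairwise_ge // head_pairwise_ge.
Qed.

(** * Rayleigh quotient bounds *)

Lemma lambda_min_quad (R : rcfType) n (A : 'M[R]_n) (v : 'rV[R]_n) : A^T = A ->
  lambda_min A * (v *m v^T) 0 0 <= (v *m A *m v^T) 0 0.
Proof.
move=> /quad_eigvals[d [dA /(_ v)[w [w0 -> -> _]]]].
rewrite mulr_sumr; apply: ler_sum => i _; rewrite ler_wpM2r //.
by case/andP: (dA i).
Qed.

Lemma size_eigvals (R : rcfType) n (A : 'M[R]_n) : A^T = A -> size (eigvals A) = n.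
Proof.
move=> /symmetric_spectral[d [/eigvals_perm/perm_size -> _]].
by rewrite size_codom card_ord.
Qed.

Lemma normsq_gt0 (R : realDomainType) n (v : 'rV[R]_n) :
  v != 0 -> 0 < (v *m v^T) 0 0.
Proof.
move=> /rV0Pn[j vj]; rewrite mxE (bigD1 j) //= ltr_pwDl // ?mxE.
  by rewrite -expr2 exprn_even_gt0.
by apply: sumr_ge0 => k _; rewrite mxE -expr2 sqr_ge0.
Qed.

Lemma normsq_ge0 (R : realDomainType) n (v : 'rV[R]_n) : 0 <= (v *m v^T) 0 0.
Proof. by rewrite mxE sumr_ge0 // => k _; rewrite mxE -expr2 sqr_ge0. Qed.

(** Evaluate the bound at an eigenvector: the form there is the eigenvalue times a positive squared
    norm. *)
Lemma eigvals_ge (R : rcfType) n (A : 'M[R]_n) (c x : R) :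
  (forall v : 'rV[R]_n, c * (v *m v^T) 0 0 <= (v *m A *m v^T) 0 0) ->
  x \in eigvals A -> c <= x.
Proof.
move=> cA /flatten_mapP[y yr /nseqP[-> _]].
have p0 : char_poly A != 0 by rewrite monic_neq0 // char_poly_monic.
have : root (char_poly A) y.
  by move: yr; rewrite mem_rev -(roots_on_rootsR p0) => /andP[].
rewrite -eigenvalue_root_char => /eigenvalueP[v vA v0].
by have := cA v; rewrite vA -scalemxAl [leRHS]mxE ler_pM2r // normsq_gt0.
Qed.

(** A bound on every eigenvalue suffices, without a min-max principle. Symmetry gives the list
    length [n], so index [i.-1] is in range and the default of [nth] is never returned. *)
Lemma lambda_ge (R : rcfType) n (A : 'M[R]_n) (c : R) (i : nat) : A^T = A ->
  (forall v : 'rV[R]_n, c * (v *m v^T) 0 0 <= (v *m A *m v^T) 0 0) ->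
  (1 <= i <= n)%N -> c <= lambda i A.
Proof.
move=> Asym cA /andP[i0 ilen]; apply: (eigvals_ge cA).
by rewrite mem_nth // size_eigvals // prednK.
Qed.

(** * Gram matrices and their shifts by a positive scalar *)

Lemma gram_quad (R : comNzRingType) n p (M : 'M[R]_(n, p)) (v : 'rV[R]_n) :
  v *m (M *m M^T) *m v^T = (v *m M) *m (v *m M)^T.
Proof. by rewrite trmx_mul !mulmxA. Qed.

Lemma gram_sym (R : comNzRingType) n p (M : 'M[R]_(n, p)) :
  (M *m M^T)^T = M *m M^T.
Proof. by rewrite trmx_mul trmxK. Qed.

Lemma lambda_min_gram_ge0 (R : rcfType) n p (M : 'M[R]_(n, p)) :
  0 <= lambda_min (M *m M^T).
Proof.
(* The last entry is either the default 0, which covers the empty list, or a genuine eigenvalue. *)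
have := mem_last 0 (eigvals (M *m M^T)).
rewrite -/(lambda_min _) in_cons => /orP[/eqP-> //|]; apply: eigvals_ge => v.
by rewrite mul0r gram_quad normsq_ge0.
Qed.

(** Written in terms of [u], the image of the test vector under the resolvent, so that no inverse
    appears. *)
Lemma resolvent_quad (R : rcfType) n p (M : 'M[R]_(n, p)) (s : R) (u : 'rV[R]_n) :
  let K := M *m M^T in 0 < s ->
  lambda_min K / (lambda_min K + s)
    * ((u *m (K + s%:M)) *m (u *m (K + s%:M))^T) 0 0
  <= (lambda_max K + s) * (u *m K *m u^T) 0 0.
Proof.
move=> K s0; have l0 : 0 <= lambda_min K := lambda_min_gram_ge0 M.
have Ksym : K^T = K := gram_sym M.
have [d [dK /(_ u)[w [w0 uu uKu uKKu]]]] := quad_eigvals Ksym.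
have -> : ((u *m (K + s%:M)) *m (u *m (K + s%:M))^T) 0 0
    = \sum_i (d i + s) ^+ 2 * w i.
  (* Expand the square of [K + s]; the quadratic term is where the form in [K *m K] from
     [quad_eigvals] enters. *)
  transitivity (\sum_i d i ^+ 2 * w i + (s * 2) * (\sum_i d i * w i)
      + s ^+ 2 * \sum_i w i).
    have KsT : (K + s%:M)^T = K + s%:M by rewrite raddfD /= tr_scalar_mx Ksym.
    have -> : u *m (K + s%:M) *m (u *m (K + s%:M))^T
        = (u *m K *m K + (s * 2) *: (u *m K) + s ^+ 2 *: u) *m u^T.
      rewrite trmx_mul KsT mulmxA; congr (_ *m _).
      rewrite mulmxDr mul_mx_scalar [u *m _]mulmxDr mul_mx_scalar mulmxDl -scalemxAl.
      by move: (u *m K *m K) (u *m K) => X Y; apply/rowP => j; rewrite !mxE; ring.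
    by rewrite -uu -uKu -uKKu !mulmxDl -!scalemxAl; rewrite !mxE.
  rewrite !mulr_sumr -!big_split /=; apply: eq_bigr => i _; ring.
rewrite uKu !mulr_sumr; apply: ler_sum => i _.
rewrite [in leLHS]mulrA [in leRHS]mulrA ler_wpM2r //.
have /andP[ld dM] := dK i.
have ls : 0 < lambda_min K + s by rewrite ltr_wpDl.
(* With t = [d i], the intermediate value t (t + s) separates the two ends of the spectrum: below it
   uses lambda_min <= t, above it t <= lambda_max. *)
rewrite expr2 mulrA; apply: (@le_trans _ _ (d i * (d i + s))).
  rewrite ler_wpM2r //; first by lra.
  rewrite mulrAC ler_pdivrMr //; nra.
by nra.
Qed.

(** A left kernel vector [v] satisfies |v M|^2 + s |v|^2 = 0, which forces [v = 0]. *)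
Lemma gram_add_scalar_unit (R : realFieldType) n p (M : 'M[R]_(n, p)) (s : R) :
  0 < s -> M *m M^T + s%:M \in unitmx.
Proof.
move=> s0; rewrite -row_free_unit; apply: inj_row_free => v.
rewrite mulmxDr mul_mx_scalar => /(congr1 (fun w => (w *m v^T) 0 0)).
rewrite mulmxDl -scalemxAl gram_quad mul0mx [LHS]mxE [X in _ + X]mxE [RHS]mxE => /eqP.
apply: contraTeq => v0; rewrite gt_eqF // ltr_wpDl ?normsq_ge0 //.
by rewrite mulr_gt0 // normsq_gt0.
Qed.

(** * Jacobians and kernel matrices in the row-vector convention *)

Lemma continuous_mulmxr (R : realType) n p (B : 'M[R]_(n, p)) :
  continuous (mulmxr B : 'rV[R]_n -> 'rV[R]_p).
Proof.
move=> v; apply: differentiable_continuous.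
(* A product [v *m B] is a combination of the fixed rows of [B] with the coordinates of [v] as
   coefficients. *)
have -> : (mulmxr B : 'rV[R]_n -> 'rV[R]_p) =
    \sum_(j < n) (fun v : 'rV[R]_n => v 0 j *: row j B).
  by apply/funext => u; rewrite fct_sumE /= mulmx_sum_row.
apply: differentiable_sum => j; apply: differentiableZl.
exact: differentiable_coord.
Qed.

Lemma grad_comp (R : realType) n m p (f : 'rV[R]_n -> 'rV[R]_m)
    (g : 'rV[R]_m -> 'rV[R]_p) (x : 'rV[R]_n) :
  differentiable f x -> differentiable g (f x) ->
  grad (g \o f) x = grad g (f x) *m grad f x.
Proof.
move=> df dg; rewrite /grad -trmx_mul; congr _^T; apply/row_matrixP => i.
by rewrite !rowE mulmxA /jacobian !mul_rV_lin1 diff_comp.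
Qed.

Lemma grad_mulmxr (R : realType) n p (B : 'M[R]_(n, p)) (x : 'rV[R]_n) :
  grad (mulmxr B) x = B^T.
Proof.
rewrite /grad; congr _^T; apply/row_matrixP => i.
by rewrite !rowE /jacobian mul_rV_lin1 diff_lin //; exact: continuous_mulmxr.
Qed.

(** Samples are rows, so this is the transpose of the matrix Phi(X) with feature columns; kernel
    matrices take the form [F *m F^T]. *)
Definition feature_mx (R : realType) d m N (Phi : 'rV[R]_d -> 'rV[R]_m)
  (X : 'M[R]_(N, d)) : 'M[R]_(N, m) := \matrix_i Phi (row i X).

Lemma kernel_mxE (R : realType) d m p q (Phi : 'rV[R]_d -> 'rV[R]_m)
    (X : 'M[R]_(p, d)) (X' : 'M[R]_(q, d)) :
  kernel_mx Phi X X' = feature_mx Phi X *m (feature_mx Phi X')^T.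
Proof.
by apply/matrixP => i j; rewrite !mxE; apply: eq_bigr => k _; rewrite !mxE.
Qed.

(** * Block Gram matrices *)

Lemma block_gramE (R : realType) N d r p (J : 'rV[R]_d -> 'M[R]_(r, p))
    (X : 'M[R]_(N, d)) :
  let G := \mxcol_(i < N) J (row i X) in
  block_gram (fun x x' => J x *m (J x')^T) X = G *m G^T.
Proof. by rewrite /= tr_mxcol mul_mxcol_mxrow. Qed.

(** Multiplying each block row of the stacked Jacobian by [B x_i] amounts to applying [B x_i] to the
    i-th block of the test vector, which scales its squared norm by at least [c]. *)
Lemma block_gram_ge (R : realType) N d r q p (J : 'rV[R]_d -> 'M[R]_(q, p))
    (B : 'rV[R]_d -> 'M[R]_(r, q)) (X : 'M[R]_(N, d)) (c : R) (k : nat) :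
  (forall i (v : 'rV[R]_r), c * (v *m v^T) 0 0
     <= ((v *m B (row i X)) *m (v *m B (row i X))^T) 0 0) ->
  (1 <= k <= N * r)%N ->
  c * lambda_min (block_gram (fun x x' => J x *m (J x')^T) X)
    <= lambda k (block_gram (fun x x' => (B x *m J x) *m (B x' *m J x')^T) X).
Proof.
move=> cB kN; rewrite (block_gramE (fun x => B x *m J x)) block_gramE.
set G := \mxcol_i J _; set H := \mxcol_i _.
apply: lambda_ge; first exact: gram_sym.
  move=> v; pose w := \mxrow_(i < N) (submxrow v i *m B (row i X)).
  have vH : v *m H = w *m G.
    rewrite -{1}[v]submxrowK !mul_mxrow_mxcol.
    by apply: eq_bigr => i _; rewrite mulmxA.
  have normsq_mxrow a (V : forall i : 'I_N, 'rV[R]_a) :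
      (\mxrow_i V i *m (\mxrow_i V i)^T) 0 0 = \sum_i (V i *m (V i)^T) 0 0.
    by rewrite tr_mxrow mul_mxrow_mxcol summxE.
  rewrite gram_quad vH -gram_quad.
  apply: le_trans (lambda_min_quad _ (gram_sym G)).
  (* Nonnegativity of the Gram eigenvalue lets it multiply the norm comparison, which then splits
     over blocks. *)
  rewrite mulrAC mulrC ler_wpM2l ?lambda_min_gram_ge0 //.
  rewrite normsq_mxrow -{1 2}[v]submxrowK normsq_mxrow mulr_sumr.
  by apply: ler_sum => i _; exact: cB.
by rewrite sum_nat_const card_ord.
Qed.

Theorem corollary1 (R : realType) (dS cS dT cT NS NT m pA : nat)
  (Phi : 'rV[R]_dS -> 'rV[R]_m)
  (XS : 'M[R]_(NS, dS)) (YS : 'M[R]_(NS, cS)) (sigmaS : R)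
  (a : 'rV[R]_pA -> 'rV[R]_dT -> 'rV[R]_dS) (thetaA : 'rV[R]_pA)
  (b : 'M[R]_(cT, cS))
  (DT : NT.-tuple ('rV[R]_dT * 'rV[R]_cT)) (cA : R)
  (Phi_diff : forall z : 'rV[R]_dS, differentiable Phi z)
  (a_diff : forall (x : 'rV[R]_dT) (t : 'rV[R]_pA),
     differentiable (fun t' : 'rV[R]_pA => a t' x) t)
  (sigmaS_gt0 : 0 < sigmaS) (cA_gt0 : 0 < cA)
  (Theta_SA_ge : forall xy : 'rV[R]_dT * 'rV[R]_cT, xy \in DT ->
     cA * (lambda_max (K_S Phi XS) + sigmaS)
       <= lambda_min (Theta_SA Phi a thetaA xy.1 xy.1)) :
  forall i : nat, (1 <= i <= NT * cT)%N ->
    lambda_min (b *m YS^T *m YS *m b^T)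
      * ((cA * lambda_min (K_S Phi XS)) / (lambda_min (K_S Phi XS) + sigmaS))
      * lambda_min (block_gram (Theta_A a thetaA) (features DT))
    <= lambda i (block_gram (Theta_TA Phi XS YS sigmaS a b thetaA) (features DT)).
Proof.
move=> k kN.
pose F := feature_mx Phi XS.
have KE : K_S Phi XS = F *m F^T by rewrite /K_S kernel_mxE.
pose Q := invmx (K_S Phi XS + sigmaS%:M).
pose P := b *m YS^T *m Q^T *m F.
have gradT x : grad (fun t => f_T Phi XS YS sigmaS a b t x) thetaA
    = P *m grad Phi (a thetaA x) *m grad (fun t => a t x) thetaA.
  (* The trained model is a fixed linear map of the features, so only [Phi] and [a] contribute
     nontrivial Jacobians. *)
  have -> : (fun t => f_T Phi XS YS sigmaS a b t x) =
      mulmxr P^T \o (Phi \o (fun t => a t x)).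
    apply/funext => t; rewrite /= /f_T /f_S kernel_mxE /P !trmx_mul !trmxK !mulmxA.
    (* A single input is a one-row data matrix, whose feature matrix is the row [Phi] of that
       input. *)
    congr (_ *m _ *m _ *m _ *m _); apply/row_matrixP => i.
    by rewrite rowK row_id ord1 row_id.
  have da := a_diff x thetaA.
  rewrite grad_comp; last 2 first.
  - exact: differentiable_comp.
  - exact/linear_differentiable/continuous_mulmxr.
  by rewrite grad_mulmxr trmxK grad_comp // mulmxA.
have -> : Theta_TA Phi XS YS sigmaS a b thetaA = fun x x' =>
    ((P *m grad Phi (a thetaA x)) *m grad (fun t => a t x) thetaA) *m
    ((P *m grad Phi (a thetaA x')) *m grad (fun t => a t x') thetaA)^T.
  by apply/funext => x; apply/funext => x'; rewrite /Theta_TA !gradT.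
apply: (@block_gram_ge _ _ _ _ _ _ (fun x => grad (fun t => a t x) thetaA)
  (fun x => P *m grad Phi (a thetaA x))) => // i v.
set x := row i _; set J := grad Phi _.
have xD : cA * (lambda_max (K_S Phi XS) + sigmaS) <= lambda_min (J *m J^T).
  by rewrite /J /x rowK; exact: Theta_SA_ge (mem_tnth i DT).
have l0 : 0 <= lambda_min (K_S Phi XS) by rewrite KE lambda_min_gram_ge0.
have Ku : K_S Phi XS + sigmaS%:M \in unitmx.
  by rewrite KE gram_add_scalar_unit.
(* This [u] links the two sides: [u *m F] is [v *m P], while multiplying [u] by the shifted kernel
   matrix recovers [v *m (b *m YS^T)]. *)
pose u := v *m b *m YS^T *m Q^T.
have uF : v *m P = u *m F by rewrite /P /u !mulmxA.
have uK : u *m (K_S Phi XS + sigmaS%:M) = v *m (b *m YS^T).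
  have Ksym : (K_S Phi XS + sigmaS%:M)^T = K_S Phi XS + sigmaS%:M.
    by rewrite linearD /= tr_scalar_mx KE gram_sym.
  by rewrite /u /Q trmx_inv Ksym mulmxKV // mulmxA.
have := resolvent_quad F u sigmaS_gt0; rewrite /= -KE uK.
have := lambda_min_quad v (gram_sym (b *m YS^T)).
have -> : b *m YS^T *m YS *m b^T = (b *m YS^T) *m (b *m YS^T)^T.
  by rewrite trmx_mul trmxK !mulmxA.
rewrite gram_quad.
set y := (_ *m (v *m (b *m YS^T))^T) 0 0; set lY := lambda_min (_ *m _).
have := lambda_min_quad (v *m P) (gram_sym J).
rewrite gram_quad -[v *m P *m J]mulmxA.
have -> : v *m P *m (v *m P)^T = u *m K_S Phi XS *m u^T.
  by rewrite uF KE gram_quad.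
set z := (v *m v^T) 0 0; set q := (u *m _ *m _) 0 0.
move=> hz hy hq.
have q0 : 0 <= q by rewrite /q KE gram_quad normsq_ge0.
have r0 : 0 <= lambda_min (K_S Phi XS) / (lambda_min (K_S Phi XS) + sigmaS).
  by rewrite divr_ge0 // addr_ge0 // ltW.
(* Going down from |v P J|^2: [hz] extracts the least eigenvalue of [J *m J^T], [xD] replaces it by
   [cA] times the shifted [lambda_max], [hq] passes from [q] to [y], and [hy] from [y] to
   [lY * z]. *)
apply: le_trans hz; apply: le_trans (ler_wpM2r q0 xD).
rewrite -[leRHS]mulrA; apply: le_trans (ler_wpM2l (ltW cA_gt0) hq).
rewrite -mulrA [leLHS](_ : _ = cA * (lambda_min (K_S Phi XS) /
  (lambda_min (K_S Phi XS) + sigmaS) * (lY * z))); last by ring.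
by rewrite ler_wpM2l ?(ltW cA_gt0) // ler_wpM2l.
Qed.
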